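(* Let $m\ge1$ and let $\epsilon=(\epsilon_1,\dots,\epsilon_s)$ be a circular sequence of level $\lambda_\epsilon\ge0$ with $\epsilon_i\in\{1,0,-1\}$ for all $i$. Then $c(\Gamma^m_\epsilon)=\max\{0,m-\lambda_\epsilon\}$.
   Context: Indices are mod $s$. $\epsilon$ is a circular sequence of level $\lambda\ge0$ if $\sum_{j=1}^s\epsilon_j=0$, $|\sum_{j=a}^b\epsilon_j|\le\lambda$ for all $1\le a\le s$, $a\le b\le a+s-1$, with equality for some such $a,b$. Digraph $\Gamma^m_\epsilon$: vertices $x_{i,t}$, $0\le i\le m-1$, $t\in\{1,\dots,s\}$, some ''marked zero''. If $s=1$: if $\epsilon_1\ne0$ all vertices are marked zero and there are no edges; if $\epsilon_1=0$ nothing is marked and each $x_{i,1}$ carries a loop of weight $0$. If $s\ge2$: for each $t$ let $A_t=\max(\epsilon_t,0)$, $B_t=\max(-\epsilon_{t+1},0)$; for each $j\in\{0,\dots,m-1\}$: if $j\ge\max(A_t,B_t)$ add an edge from $x_{j-A_t,t}$ to $x_{j-B_t,t+1}$ of weight $A_t-B_t$; if $A_t\le j<B_t$ mark $x_{j-A_t,t}$ zero; if $B_t\le j<A_t$ mark $x_{j-B_t,t+1}$ zero. Each connected component is a directed path or a directed cycle; $c(\Gamma^m_\epsilon)$ is the number of components that are directed cycles (circular digraphs). *)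

(* Defs.v *)
From HB Require Import structures.
From mathcomp Require Import all_boot all_order all_algebra.

Set Implicit Arguments.
Unset Strict Implicit.
Unset Printing Implicit Defensive.

Import Order.TTheory GRing.Theory Num.Theory.
Local Open Scope ring_scope.

(* Positions 1, ..., s are shifted to 0, ..., s - 1, and indices mod s are
   reduced with %% s (for sums) or advanced with ordS (for vertices). *)

Definition window_sum (s : nat) (eps : s.-tuple int) (a b : nat) : int :=
  \sum_(a <= j < b.+1) eps`_(j %% s)%N.

(* a <= b <= a + s - 1 is written (a <= b < a + s)%N to avoid truncated
   subtraction. *)
Definition circular_sequence (s : nat) (eps : s.-tuple int) (lambda : nat) :
    Prop :=
  [/\ \sum_(t < s) tnth eps t = 0,
      forall a b : nat, (a < s)%N -> (a <= b < a + s)%N ->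
        `|window_sum eps a b| <= lambda%:Z
    & exists a b : nat, [/\ (a < s)%N, (a <= b < a + s)%N
        & `|window_sum eps a b| = lambda%:Z]].

Record marked_digraph := MarkedDigraph {
  vertex : finType;
  edge : finType;
  src : edge -> vertex;
  tgt : edge -> vertex;
  weight : edge -> int;
  marked_zero : {set vertex}
}.

Section Components.
Variable G : marked_digraph.

Definition adjacent : rel (vertex G) := fun x y =>
  [exists e : edge G, ((src e == x) && (tgt e == y))
                   || ((src e == y) && (tgt e == x))].

Definition component (x : vertex G) : {set vertex G} :=
  [set y | connect adjacent x y].

Definition components : {set {set vertex G}} :=
  [set component x | x : vertex G].

(* The subdigraph induced on C is a single directed cycle: p lists its edges
   in cyclic order, the sources of these edges being the vertices of C, each
   met exactly once. A loop on one vertex is a directed cycle. *)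
Definition directed_cycle (C : {set vertex G}) : bool :=
  (C != set0) &&
  [exists p : #|C|.-tuple (edge G),
    [&& cycle (fun e f => tgt e == src f) p,
        perm_eq [seq src e | e <- p] (enum C)
      & [forall e : edge G, (src e \in C) && (tgt e \in C) ==> (e \in p)]]].

Definition num_cycles : nat := #|[set C in components | directed_cycle C]|.

End Components.

Section Gamma.
Variables (m s : nat) (eps : s.-tuple int).

Definition shiftA (t : 'I_s) : nat := `|Num.max (tnth eps t) 0|%N.
Definition shiftB (t : 'I_s) : nat := `|Num.max (- tnth eps (ordS t)) 0|%N.

(* Truncated subtraction; it is only used below where k <= j. *)
Definition ord_sub (j : 'I_m) (k : nat) : 'I_m :=
  Ordinal (leq_ltn_trans (leq_subr k j) (ltn_ord j)).

(* The case s = 1: a loop at (j, t) for every vertex if the only entry is 0,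
   no edge otherwise. *)
Definition Gamma_one : marked_digraph :=
  let E := {x : 'I_m * 'I_s | tnth eps x.2 == 0} in
  @MarkedDigraph ('I_m * 'I_s)%type E
    (fun e : E => val e) (fun e : E => val e) (fun=> 0)
    [set x | tnth eps x.2 != 0].

(* The case s >= 2: the edge (j, t) goes from (j - A_t, t) to
   (j - B_t, t + 1). *)
Definition Gamma_many : marked_digraph :=
  let E := {x : 'I_m * 'I_s | (maxn (shiftA x.2) (shiftB x.2) <= x.1)%N} in
  @MarkedDigraph ('I_m * 'I_s)%type E
    (fun e : E => let: (j, t) := val e in (ord_sub j (shiftA t), t))
    (fun e : E => let: (j, t) := val e in (ord_sub j (shiftB t), ordS t))
    (fun e : E => let: (j, t) := val e in (shiftA t)%:Z - (shiftB t)%:Z)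
    ([set (ord_sub x.1 (shiftA x.2), x.2)
        | x : 'I_m * 'I_s & (shiftA x.2 <= x.1 < shiftB x.2)%N]
     :|: [set (ord_sub x.1 (shiftB x.2), ordS x.2)
        | x : 'I_m * 'I_s & (shiftB x.2 <= x.1 < shiftA x.2)%N]).

Definition Gamma : marked_digraph :=
  if s == 1%N then Gamma_one else Gamma_many.

End Gamma.

(* Main.v *)
(** Label the edges of the graph by [(j, t)], the edge from [x_{j - A_t, t}] to
    [x_{j - B_t, t + 1}].  Since [A_{t+1} - B_t] is the entry of [eps] at
    [t + 1], the only edge that can follow [(j, t)] is
    [(j + eps_{t+1}, t + 1)].  Hence a directed cycle goes once around the
    positions and follows the partial sums of [eps]: the cycles correspond to
    the heights [j] for which [j] plus every partial sum lies in [0, m - 1].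
    There are [m - (M - N)] such heights (none if this is negative), where [M]
    and [N] are the extreme partial sums, and [M - N] is the level because the
    window sums are the differences of partial sums. *)

Require Import Defs.
From mathcomp Require Import all_boot all_order all_algebra.
From mathcomp Require Import zify.

Set Implicit Arguments.
Unset Strict Implicit.
Unset Printing Implicit Defensive.

Import Order.TTheory GRing.Theory Num.Theory.
Local Open Scope ring_scope.

(** * Counting directed cycles among the components of a digraph *)

Section Digraph.
Variable G : marked_digraph.

Definition follows : rel (edge G) := fun e f => tgt e == src f.

Lemma adjacent_connectC : connect_sym (@adjacent G).
Proof.
apply: sym_connect_sym => x y; rewrite /adjacent.
by apply: eq_existsb => e; rewrite orbC.
Qed.

Lemma component_eq (C : {set vertex G}) (x : vertex G) :
  C \in components G -> x \in C -> C = component x.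
Proof.
case/imsetP=> y _ ->; rewrite inE => yx; apply/setP=> z; rewrite !inE.
exact: same_connect adjacent_connectC _ _ yx z.
Qed.

(** To count the cycles, choose one vertex on each: [f] picks the representatives, indexed by
    [T]. *)
Lemma num_cycles_transversal (I : finType) (T : {set I}) (f : I -> vertex G) :
    {in T, forall i, directed_cycle (component (f i))} ->
    {in T &, injective (fun i => component (f i))} ->
    (forall C, C \in components G -> directed_cycle C ->
       exists2 i, i \in T & f i \in C) ->
  num_cycles G = #|T|.
Proof.
move=> cycT injT surT; rewrite -(card_in_imset injT); congr #|pred_of_set _|.
apply/setP=> C; rewrite inE; apply/andP/imsetP=> [[cC dC]|[i iT ->]].
  have [i iT fiC] := surT C cC dC; exists i => //.
  exact: component_eq.
by split; [apply: imset_f | apply: cycT].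
Qed.

(** What is kept of a cycle: a list of edges inside which [next] can be iterated forever. *)
Lemma follows_next_cycle (C : {set vertex G}) : directed_cycle C ->
  exists2 p : seq (edge G), p != [::] &
    {in p, forall e, [/\ src e \in C, next p e \in p & tgt e = src (next p e)]}.
Proof.
case/andP=> C0 /existsP[p /and3P[cp pC _]]; exists (tval p) => [|e ep].
  apply: contraNneq C0 => p0; move: pC; rewrite p0 /= => /perm_size/eqP.
  by rewrite eq_sym -cardE cards_eq0.
split; last exact/eqP/(next_cycle cp).
  by rewrite -mem_enum -(perm_mem pC) map_f.
by rewrite mem_next.
Qed.

Hypotheses (src_inj : injective (@src G)) (tgt_inj : injective (@tgt G)).

(** Injectivity leaves at most one edge out of each vertex and one into it. Hence an edge touching
    [src f] is [f] or its predecessor in [p], and adjacency never leaves the cycle. *)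
Lemma component_cycle (p : seq (edge G)) (e : edge G) :
  cycle follows p -> e \in p -> component (src e) = [set src f | f in p].
Proof.
move=> cp ep; apply/setP=> y; rewrite inE; apply/idP/imsetP=> [|[f fp ->]].
  have cl : closed (@adjacent G) (mem [set src f | f in p]).
    apply: (intro_closed adjacent_connectC) => x z + /imsetP[f fp xf].
    case/existsP=> g /orP[] /andP[/eqP gx /eqP gz].
      have gf : g = f by apply: src_inj; rewrite gx.
      rewrite -gz gf (eqP (next_cycle cp fp)); apply: imset_f.
      by rewrite mem_next.
    have gf : g = prev p f.
      by apply: tgt_inj; rewrite gz xf (eqP (prev_cycle cp fp)).
    by rewrite -gx gf; apply: imset_f; rewrite mem_prev.
  move=> /(closed_connect cl); rewrite imset_f // => /esym/imsetP[f fp ->].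
  by exists f.
have cs : cycle (@adjacent G) (map (@src G) p).
  rewrite cycle_map; apply: sub_cycle cp => a b ab.
  by apply/existsP; exists a; rewrite eqxx (eqP ab) eqxx.
by apply: (connect_cycle cs); apply: map_f.
Qed.

Lemma directed_cycle_imset (p : seq (edge G)) :
    p != [::] -> uniq p -> cycle follows p ->
  directed_cycle [set src f | f in p].
Proof.
move=> p0 up cp; apply/andP; split.
  case: p p0 {up cp} => // e p _; apply/set0Pn; exists (src e).
  by rewrite imset_f ?mem_head.
have szp : size p == #|[set src f | f in p]|.
  by rewrite card_imset // (card_uniqP up).
apply/existsP; exists (Tuple szp); apply/and3P; split=> //=.
  apply: uniq_perm; rewrite ?map_inj_uniq ?enum_uniq // => x.
  by rewrite mem_enum; apply/mapP/imsetP.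
apply/forallP=> e; apply/implyP=> /andP[/imsetP[f fp /src_inj ->] _] //.
Qed.

End Digraph.

(** * Closed walks as sequences, and the size of an interval *)

Lemma cycle_mkseq (T : Type) (r : rel T) (g : nat -> T) (n : nat) :
  g n = g 0%N -> (forall k, r (g k) (g k.+1)) -> cycle r (mkseq g n).
Proof.
case: n => // n gn rg; rewrite /mkseq /= -[in rcons _ _]gn.
have -> : rcons (map g (iota 1 n)) (g n.+1) = map g (iota 1 n.+1).
  by rewrite -[in RHS](addn1 n) iotaD map_cat cats1 add1n.
by elim: n.+1 0%N {gn} => //= k IH i; rewrite rg IH.
Qed.

(** Shift by [a]; truncated subtraction gives the right count, 0, when [m < a + b]. *)
Lemma card_ord_between (m a b : nat) :
  #|[set j : 'I_m | (a <= j)%N && (j + b < m)%N]| = (m - (a + b))%N.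
Proof.
have lt_m (i : 'I_(m - (a + b))) : (a + i < m)%N by case: i => i /=; lia.
rewrite -[RHS]card_ord -(card_imset _ (_ : injective (fun i => Ordinal (lt_m i)))).
  apply: eq_card => j; rewrite inE; apply/idP/imsetP => [h|[i _ ->] /=].
    have lt_j : (j - a < m - (a + b))%N by lia.
    by exists (Ordinal lt_j) => //; apply: val_inj => /=; lia.
  by case: i => i /=; lia.
by move=> i k /(congr1 val) /= /addnI /val_inj.
Qed.

(** * Partial sums of a circular sequence *)

Section PartialSums.
Variables (s : nat) (eps : s.-tuple int).
Hypotheses (s_gt0 : (0 < s)%N) (eps_sum0 : \sum_(t < s) tnth eps t = 0).

Definition partial_sum (n : nat) : int := \sum_(0 <= i < n) eps`_(i %% s).

Lemma partial_sum0 : partial_sum 0 = 0.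
Proof. by rewrite /partial_sum big_geq. Qed.

Lemma partial_sumS n : partial_sum n.+1 = partial_sum n + eps`_(n %% s).
Proof. by rewrite /partial_sum big_nat_recr. Qed.

Lemma partial_sum_period n : partial_sum (n + s) = partial_sum n.
Proof.
elim: n => [|n IH]; last by rewrite addSn !partial_sumS IH modnDr.
rewrite add0n partial_sum0 -[RHS]eps_sum0 /partial_sum big_mkord.
by apply: eq_bigr => i _; rewrite modn_small // -tnth_nth.
Qed.

Lemma partial_sum_full : partial_sum s = 0.
Proof. by have := partial_sum_period 0; rewrite add0n partial_sum0. Qed.

Lemma partial_sum_mod n : partial_sum (n %% s) = partial_sum n.
Proof.
rewrite [in RHS](divn_eq n s) addnC; elim: (n %/ s)%N => [|k IH].
  by rewrite addn0.
by rewrite mulSn addnCA addnC partial_sum_period.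
Qed.

Lemma window_sumE a b : (a <= b)%N ->
  window_sum eps a b = partial_sum b.+1 - partial_sum a.
Proof.
move=> ab; rewrite /window_sum /partial_sum.
by rewrite [X in _ = X - _](@big_cat_nat _ _ _ a) ?leqW //= addrAC subrr add0r.
Qed.

(** Here [- a] and [b] are the least and greatest partial sums; the signs are right because the
    empty sum is 0. *)
Lemma level_partial_sum (lambda : nat) : circular_sequence eps lambda ->
  exists a b : nat, [/\ (a + b)%N = lambda,
    forall n, - a%:Z <= partial_sum n <= b%:Z,
    exists n, partial_sum n = - a%:Z & exists n, partial_sum n = b%:Z].
Proof.
case=> _ le_lambda [u [v [us uv Euv]]].
case: (@arg_minP _ _ _ (Ordinal s_gt0) xpredT (partial_sum \o val) isT) => kmin _ /= Hmin.
case: (@arg_maxP _ _ _ (Ordinal s_gt0) xpredT (partial_sum \o val) isT) => kmax _ /= Hmax.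
have bounds n : partial_sum kmin <= partial_sum n <= partial_sum kmax.
  rewrite -(partial_sum_mod n); have ns := ltn_pmod n s_gt0.
  by rewrite (Hmin (Ordinal ns) isT) (Hmax (Ordinal ns) isT).
have diff (i k : 'I_s) : `|partial_sum i - partial_sum k| <= lambda%:Z.
  wlog ki : i k / (k < i)%N => [H|].
    case: (ltngtP i k) => [ik|ki|/val_inj ->]; last by rewrite subrr normr0.
      by rewrite distrC; apply: H.
    exact: H.
  have := le_lambda k i.-1 (ltn_ord k); rewrite window_sumE; last lia.
  by rewrite prednK; [apply; have := ltn_ord i; lia | lia].
have := bounds 0%N; rewrite partial_sum0 => /andP[min0 max0].
(* [diff] bounds maximum minus minimum by the level; the window from [u] to [v], which attains the
   level, gives the reverse inequality. *)
have := diff kmax kmin; have := bounds u; have := bounds v.+1.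
move: Euv; rewrite window_sumE; last by case/andP: uv.
move=> Euv bv bu le_l.
exists `|partial_sum kmin|%N, `|partial_sum kmax|%N.
have E1 : - `|partial_sum kmin|%N%:Z = partial_sum kmin by lia.
have E2 : `|partial_sum kmax|%N%:Z = partial_sum kmax by lia.
split; first by lia.
- by move=> n; rewrite E1 E2.
- by exists kmin.
- by exists kmax.
Qed.

End PartialSums.

(** * Cycles of [Gamma_many] and their heights *)

Section GammaMany.
Variables (m s : nat) (eps : s.-tuple int).
Hypotheses (s_gt0 : (0 < s)%N) (eps_sum0 : \sum_(t < s) tnth eps t = 0).

Local Notation G := (Gamma_many m eps).
Local Notation Q := (partial_sum eps).

Definition edge_label (e : edge G) : 'I_m * 'I_s := val e.

Lemma edge_labelP (e : edge G) :
  (maxn (shiftA eps (edge_label e).2) (shiftB eps (edge_label e).2)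
     <= (edge_label e).1)%N.
Proof. exact: (valP e). Qed.

Lemma edge_label_inj : injective edge_label.
Proof. exact: val_inj. Qed.

Lemma src_label (e : edge G) : src e =
  (ord_sub (edge_label e).1 (shiftA eps (edge_label e).2), (edge_label e).2).
Proof. by rewrite /edge_label /=; case: (val e). Qed.

Lemma tgt_label (e : edge G) : tgt e =
  (ord_sub (edge_label e).1 (shiftB eps (edge_label e).2),
   ordS (edge_label e).2).
Proof. by rewrite /edge_label /=; case: (val e). Qed.

(** An integer is its positive part minus its negative part, and [shiftB] looks one entry ahead. *)
Lemma shiftA_ordS (t : 'I_s) :
  (shiftA eps (ordS t))%:Z = (shiftB eps t)%:Z + tnth eps (ordS t).
Proof. by rewrite /shiftA /shiftB; move: (tnth eps _) => x; lia. Qed.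

Lemma src_many_inj : injective (@src G).
Proof.
move=> e f; rewrite !src_label => -[E1 E2]; apply: edge_label_inj.
have := edge_labelP e; have := edge_labelP f; move: E1 E2.
case: (edge_label e) (edge_label f) => [j t] [k u] /= + tu; rewrite -tu.
by move=> E1 ? ?; congr pair; apply: val_inj => /=; lia.
Qed.

Lemma tgt_many_inj : injective (@tgt G).
Proof.
move=> e f; rewrite !tgt_label => -[E1 E2]; apply: edge_label_inj.
have {}E2 : ordS (edge_label e).2 = ordS (edge_label f).2 by apply: val_inj.
have := edge_labelP e; have := edge_labelP f; move: E1 (ordS_inj E2).
case: (edge_label e) (edge_label f) => [j t] [k u] /= + tu; rewrite -tu.
by move=> E1 ? ?; congr pair; apply: val_inj => /=; lia.
Qed.

(** By [shiftA_ordS], equality of [j - B_t] and [k - A_{t+1}] says that [k - j] is the entry at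
    [t + 1]. The truncated subtractions are exact by [edge_labelP]. *)
Lemma follows_many (e f : edge G) :
  reflect ((edge_label f).2 = ordS (edge_label e).2 /\
           (edge_label f).1%:Z =
             (edge_label e).1%:Z + tnth eps (edge_label f).2)
          (follows e f).
Proof.
rewrite /follows tgt_label src_label.
have := edge_labelP e; have := edge_labelP f.
case: (edge_label e) (edge_label f) => [j t] [k u] /= hf he.
have sA := shiftA_ordS t.
apply: (iffP eqP) => [E|[tu jk]].
  have tu : ordS t = u := congr1 snd E.
  have {E} jk : (j - shiftB eps t)%N = (k - shiftA eps u)%N by case: E.
  by subst u; split=> //; lia.
by subst u; congr pair; apply: val_inj => /=; lia.
Qed.

(** With [j] the height of the edge at the last position, [j + Q k] is the height of the edge at
    position [k - 1] mod [s]. *)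
Definition cyclic_heights : {set 'I_m} :=
  [set j : 'I_m | [forall k : 'I_s, 0 <= j%:Z + Q k < m%:Z]].

Lemma cyclic_heightsP (j : 'I_m) :
  reflect (forall n, 0 <= j%:Z + Q n < m%:Z) (j \in cyclic_heights).
Proof.
rewrite inE; apply: (iffP forallP) => H n; last exact: H.
by rewrite -partial_sum_mod //; apply: (H (Ordinal (ltn_pmod n s_gt0))).
Qed.

Lemma edge_at (j : 'I_m) (n : nat) : j \in cyclic_heights ->
  {e : edge G | (edge_label e).2 = (n %% s)%N :> nat &
                (edge_label e).1%:Z = j%:Z + Q n.+1}.
Proof.
move=> /cyclic_heightsP jH.
have lt_m : (`|(j%:Z + Q n.+1)%R| < m)%N by have := jH n.+1; lia.
pose t := Ordinal (ltn_pmod n s_gt0).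
have hA : tnth eps t = eps`_(n %% s) by rewrite (tnth_nth 0).
have hB : tnth eps (ordS t) = eps`_(n.+1 %% s).
  by rewrite (tnth_nth 0) /= -[in LHS]addn1 modnDml addn1.
have P : (maxn (shiftA eps (Ordinal lt_m, t).2) (shiftB eps (Ordinal lt_m, t).2)
            <= (Ordinal lt_m, t).1)%N.
  rewrite /= /shiftA /shiftB hA hB.
  (* The height [j + Q n.+1] is at least the entry at [n] because [j + Q n >= 0], and at least minus
     the entry at [n + 1] because [j + Q n.+2 >= 0]. *)
  have := jH n; have := jH n.+1; have := jH n.+2; rewrite !partial_sumS.
  lia.
exists (Sub (Ordinal lt_m, t) P : edge G); rewrite /edge_label SubK //=.
by have := jH n.+1; lia.
Qed.

(* The edge of height [j] at the last position, where the partial sum [Q s]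
   is [0] again, starts here. *)
Definition height_vertex (t : 'I_s) (j : 'I_m) : vertex G :=
  (ord_sub j (shiftA eps t), t).

(** The edges of [edge_at] close up after [s] steps by periodicity of [Q]. The last clause recovers
    [j] from the cycle, so that distinct heights give distinct cycles. *)
Lemma height_cycle (t : 'I_s) (j : 'I_m) :
    t.+1 = s -> j \in cyclic_heights ->
  exists p : seq (edge G),
    [/\ p != [::], uniq p, cycle (@follows G) p,
        exists2 e, e \in p & src e = height_vertex t j
      & {in p, forall e, (edge_label e).2 = t -> (edge_label e).1 = j}].
Proof.
move=> ts jH; pose g n := s2val (edge_at n jH).
have g2 n : (edge_label (g n)).2 = (n %% s)%N :> nat := s2valP (edge_at n jH).
have g1 n : (edge_label (g n)).1%:Z = j%:Z + Q n.+1 := s2valP' (edge_at n jH).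
have gt2 : (edge_label (g t)).2 = t.
  by apply: val_inj => /=; rewrite g2 modn_small.
have gt1 : (edge_label (g t)).1 = j.
  by apply: val_inj; have := g1 t; rewrite ts partial_sum_full // addr0 => -[].
have tE n : (n < s)%N -> (edge_label (g n)).2 = n :> nat.
  by move=> ns; rewrite g2 modn_small.
have tp : g t \in mkseq g s by apply: map_f; rewrite mem_iota /=.
exists (mkseq g s); split.
- by rewrite -size_eq0 size_mkseq -lt0n.
- rewrite map_inj_in_uniq ?iota_uniq // => a b; rewrite !mem_iota /= => la lb.
  by move=> /(congr1 (fun e => val (edge_label e).2)) /=; rewrite !tE.
- apply: cycle_mkseq => [|k].
    apply: edge_label_inj; apply: injective_projections; apply: val_inj => /=.
      apply: (can_inj absz_nat); rewrite !g1.
      by rewrite -[s.+1]add1n partial_sum_period.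
    by rewrite !g2 modnn mod0n.
  have E2 : (edge_label (g k.+1)).2 = ordS (edge_label (g k)).2.
    by apply: val_inj; rewrite /= !g2 -[in RHS]addn1 modnDml addn1.
  apply/follows_many; split=> //.
  by rewrite !g1 (tnth_nth 0) g2 partial_sumS addrA.
- by exists (g t) => //; rewrite src_label gt1 gt2.
- move=> e /mapP[n]; rewrite mem_iota /= => ns -> nt.
  by rewrite -{}gt1 -{}nt tE.
Qed.

(** Each step adds the entry of the position it reaches; the entry at the starting position [k] is
    not added, hence [Q k.+1]. *)
Lemma iter_next_label (p : seq (edge G)) (e : edge G) (n k : nat) :
    {in p, forall e, next p e \in p /\ follows e (next p e)} ->
    e \in p -> (edge_label e).2 = k :> nat ->
  let f := iter n (next p) e in
  [/\ f \in p, (edge_label f).2 = ((k + n) %% s)%N :> nat &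
      (edge_label f).1%:Z = (edge_label e).1%:Z + (Q (k + n).+1 - Q k.+1)].
Proof.
move=> Hp ep ek; elim: n => [|n /= [fp f2 f1]].
  by rewrite /= addn0 subrr addr0 modn_small // -ek.
have [nfp /follows_many [n2 n1]] := Hp _ fp.
have {}n2 : (edge_label (next p (iter n (next p) e))).2
             = ((k + n.+1) %% s)%N :> nat.
  by rewrite n2 /= f2 -[in LHS]addn1 modnDml addn1 addnS.
split=> //; rewrite n1 f1 (tnth_nth 0) n2 addnS [in RHS]partial_sumS.
by rewrite -!addrA [X in _ + (_ + X)]addrC.
Qed.

(** Walk along the cycle to the last position and read off the height [j] there. From then on the
    walk meets every height [j + Q n], and all labels lie in [[0, m - 1]]. *)
Lemma cyclic_height_exists (t : 'I_s) (C : {set vertex G}) :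
    t.+1 = s -> directed_cycle C ->
  exists2 j, j \in cyclic_heights & height_vertex t j \in C.
Proof.
move=> ts /follows_next_cycle[[//|e q] _]; set p := e :: q => Hp.
have {}Hf : {in p, forall e, next p e \in p /\ follows e (next p e)}.
  by move=> f /Hp[_ ? /eqP].
have ep : e \in p by apply: mem_head.
have [] := iter_next_label (t - (edge_label e).2) Hf ep erefl.
rewrite subnKC; last by rewrite -ltnS ts.
set f := iter _ _ _ => fp f2 _; rewrite modn_small // in f2.
exists (edge_label f).1.
  apply/cyclic_heightsP=> n.
  have [_ _] := iter_next_label n Hf fp f2.
  (* Starting from position [s - 1], the increment is [Q (n + s) - Q s], which is [Q n]. *)
  rewrite ts addnC -addnS ts partial_sum_period //.
  rewrite partial_sum_full // subr0.
  by move=> <-; rewrite ltz_nat ltn_ord.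
have [+ _ _] := Hp f fp; rewrite src_label.
by have -> : (edge_label f).2 = t by apply: val_inj.
Qed.

Lemma num_cycles_many : num_cycles G = #|cyclic_heights|.
Proof.
have lt_t : (s.-1 < s)%N by rewrite prednK.
pose t := Ordinal lt_t; have ts : t.+1 = s by rewrite /= prednK.
apply: (@num_cycles_transversal _ _ _ (height_vertex t)).
- move=> j /(height_cycle ts)[p [p0 up cp [e ep <-] _]].
  rewrite (component_cycle src_many_inj tgt_many_inj cp ep).
  exact: (directed_cycle_imset src_many_inj).
- move=> j k jH kH /= jk.
  have [p [_ _ cp [e ep Ee] Up]] := height_cycle ts jH.
  have [q [_ _ cq [f fq Ef] Uq]] := height_cycle ts kH.
  (* Equal components put the edge [f] of the second cycle on the first as well; being at the last
     position, it has height both [j] and [k]. *)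
  have : src f \in component (src e) by rewrite Ee jk Ef inE connect0.
  rewrite (component_cycle src_many_inj tgt_many_inj cp ep).
  case/imsetP=> h hp /src_many_inj fh; subst h.
  have f2 : (edge_label f).2 = t.
    by have := congr1 snd Ef; rewrite src_label.
  by rewrite -(Up f) // -(Uq f).
- by move=> C _; apply: cyclic_height_exists.
Qed.

(** Only the extreme sums [- a] and [b] matter: the condition on [j] becomes [a <= j] and
    [j + b < m]. *)
Lemma card_cyclic_heights (lambda : nat) :
  circular_sequence eps lambda -> #|cyclic_heights| = (m - lambda)%N.
Proof.
move=> /(level_partial_sum s_gt0 eps_sum0)[a [b [<- ab [u Eu] [v Ev]]]].
rewrite -card_ord_between; apply: eq_card => j; rewrite [RHS]inE.
apply/cyclic_heightsP/andP => [H|[aj jb] n].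
  by have := H u; have := H v; rewrite Eu Ev; split; lia.
by have := ab n; lia.
Qed.

End GammaMany.

(** * The case of length one, and the final count *)

Lemma num_cycles_one (m s : nat) (eps : s.-tuple int) :
  (forall t, tnth eps t = 0) -> num_cycles (Gamma_one m eps) = (m * s)%N.
Proof.
move=> eps0; set G := Gamma_one m eps.
have si : injective (@src G) by apply: val_inj.
have ti : injective (@tgt G) by apply: val_inj.
have loop (x : vertex G) : {e : edge G | src e = x & tgt e = x}.
  have x0 : tnth eps x.2 == 0 by rewrite eps0.
  by exists (Sub x x0 : edge G).
have comp (x : vertex G) : component x = [set x] /\ directed_cycle [set x].
  have [e ex xe] := loop x.
  have c1 : cycle (@follows G) [:: e] by rewrite /= /follows ex xe eqxx.
  have E : [set src f | f in [:: e]] = [set x].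
    apply/setP=> y; rewrite inE; apply/imsetP/eqP => [[f fe ->]|->].
      by rewrite -ex; move: fe; rewrite inE => /eqP ->.
    by exists e; rewrite ?inE.
  rewrite -E; split; last exact: directed_cycle_imset.
  by rewrite -(component_cycle si ti c1 (mem_head _ _)) ex.
rewrite (@num_cycles_transversal G _ [set: 'I_m * 'I_s] id).
- by rewrite cardsT card_prod !card_ord.
- by move=> x _; have [-> ] := comp x.
- by move=> x y _ _; rewrite /= !(proj1 (comp _)) => /set1_inj.
- by move=> C /imsetP[x _ ->] _; exists x; rewrite ?inE.
Qed.

Theorem theorem4p15 (m s : nat) (eps : s.-tuple int) (lambda : nat)
    (hm : (1 <= m)%N) (hs : (1 <= s)%N)
    (hcirc : circular_sequence eps lambda)
    (heps : forall t : 'I_s, tnth eps t \in [:: 1; 0; -1]) :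
  (num_cycles (Gamma m eps))%:Z = Num.max 0 (m%:Z - lambda%:Z).
Proof.
have [sum0 _ _] := hcirc.
suff -> : num_cycles (Gamma m eps) = (m - lambda)%N by lia.
rewrite /Gamma; case: eqP => [s1|_]; last first.
  by rewrite num_cycles_many // (card_cyclic_heights _ hs sum0 hcirc).
(* The only entry is the total sum, hence 0; it is also the only window, so the level is 0. *)
subst s; have eps0 t : tnth eps t = 0.
  by move: sum0; rewrite big_ord1 (ord1 t).
case: hcirc => _ _ [a [b [a1 ab]]].
have [-> ->] : a = 0%N /\ b = 0%N by lia.
rewrite /window_sum big_nat1 mod0n -(tnth_nth 0 eps ord0) eps0 normr0.
by case=> <-; rewrite num_cycles_one // muln1 subn0.
Qed.
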